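(* For every set of formulas $\Gamma\cup\{A\}$ over $\Sigma_1$: $\Gamma\vdash_{LET_F^+}A$ iff $\Gamma\models^2_{LET_F^+}A$ iff $\Gamma\models_{\mathcal{M}^1_6}A$.
   Context: Formulas are built from a denumerable set of propositional variables over $\Sigma_1=\{\land,\lor,\neg,\circ\}$. $LET_F^+$ is the natural deduction system with rules: ($\land$I) from $A,B$ infer $A\land B$; ($\land$E) from $A\land B$ infer $A$ and $B$; ($\lor$I) from $A$ (or $B$) infer $A\lor B$; ($\lor$E) from $A\lor B$ and derivations of $C$ from $[A]$ and from $[B]$ infer $C$ (discharging); ($\neg\land$I) from $\neg A$ (or $\neg B$) infer $\neg(A\land B)$; ($\neg\land$E) from $\neg(A\land B)$ and derivations of $C$ from $[\neg A]$ and from $[\neg B]$ infer $C$; ($\neg\lor$I) from $\neg A,\neg B$ infer $\neg(A\lor B)$; ($\neg\lor$E) from $\neg(A\lor B)$ infer $\neg A$ and $\neg B$; (DN) $A$ and $\neg\neg A$ inter-derivable; (EXP$^\circ$) from $\circ A,A,\neg A$ infer $B$; (PEM$^\circ$) from $\circ A$ infer $A\lor\neg A$; and, writing $A^T$ for $\circ A\land A$ and $A^F$ for $\circ A\land\neg A$: (I$\circ$) axiom $\circ\circ A$; (I$\neg\circ$) from $\circ A$ infer $\circ\neg A$; (E$\neg\circ$) from $\circ\neg A$ infer $\circ A$; (I$\land$T) from $A^T,B^T$ infer $(A\land B)^T$; (I$\land$F) from $A^F$ (or $B^F$) infer $(A\land B)^F$; (I$\lor$T) from $A^T$ (or $B^T$)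 infer $(A\lor B)^T$; (I$\lor$F) from $A^F,B^F$ infer $(A\lor B)^F$; (E$\land$T) from $(A\land B)^T$ infer $A^T$ and $B^T$; (E$\land$F) from $(A\land B)^F$ and derivations of $C$ from $[A^F]$ and from $[B^F]$ infer $C$; (E$\lor$T) from $(A\lor B)^T$ and derivations of $C$ from $[A^T]$ and from $[B^T]$ infer $C$; (E$\lor$F) from $(A\lor B)^F$ infer $A^F$ and $B^F$. A bivaluation for $LET_F^+$ is $\rho$ from formulas to $\{0,1\}$ such that for all $A,B$: $\rho(A\land B)=1$ iff $\rho(A)=\rho(B)=1$; $\rho(A\lor B)=1$ iff $\rho(A)=1$ or $\rho(B)=1$; $\rho(\neg\neg A)=1$ iff $\rho(A)=1$; $\rho(\neg(A\land B))=1$ iff $\rho(\neg A)=1$ or $\rho(\neg B)=1$; $\rho(\neg(A\lor B))=1$ iff $\rho(\neg A)=\rho(\neg B)=1$; if $\rho(\circ A)=1$ then ($\rho(\neg A)=1$ iff $\rho(A)=0$); (vp1) $\rho(\circ\circ A)=1$; (vp2) $\rho(\circ\neg A)=\rho(\circ A)$; (vp3) if $\rho(\circ A)=\rho(A)=1$ and $\rho(\circ B)=\rho(B)=1$ then $\rho(\circ(A\land B))=1$; (vp4) if $\rho(\circ A)=\rho(\neg A)=1$ then $\rho(\circ(A\land B))=1$; (vp5) if $\rho(\circ B)=\rho(\neg B)=1$ then $\rho(\circ(A\land B))=1$; (vp6) if $\rho(\circ(A\land B))=\rho(A)=\rho(B)=1$ then $\rho(\circ A)=\rho(\circ B)=1$;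 (vp7) if $\rho(\circ(A\land B))=1$ and ($\rho(\neg A)=1$ or $\rho(\neg B)=1$) then ($\rho(\circ A)=\rho(\neg A)=1$ or $\rho(\circ B)=\rho(\neg B)=1$); (vp8) if $\rho(\circ A)=\rho(A)=1$ then $\rho(\circ(A\lor B))=1$; (vp9) if $\rho(\circ B)=\rho(B)=1$ then $\rho(\circ(A\lor B))=1$; (vp10) if $\rho(\circ A)=\rho(\neg A)=1$ and $\rho(\circ B)=\rho(\neg B)=1$ then $\rho(\circ(A\lor B))=1$; (vp11) if $\rho(\circ(A\lor B))=1$ and ($\rho(A)=1$ or $\rho(B)=1$) then ($\rho(\circ A)=\rho(A)=1$ or $\rho(\circ B)=\rho(B)=1$); (vp12) if $\rho(\circ(A\lor B))=1$ and $\rho(A)=\rho(B)=0$ then $\rho(\circ A)=\rho(\circ B)=1$. $\Gamma\models^2_{LET_F^+}A$ iff every such $\rho$ giving 1 to all of $\Gamma$ gives 1 to $A$. With $\{0,1\}$ the two-element Boolean algebra ($\sqcap,\sqcup,\sim$), $\mathcal{M}^1_6$ is the logical matrix with domain $B_{LET_K}=\{z\in\{0,1\}^3:z_3\le z_1\sqcup z_2,\ z_1\sqcap z_2\sqcap z_3=0\}=\{T=(1,0,1),T_0=(1,0,0),\mathsf{b}=(1,1,0),\mathsf{n}=(0,0,0),F_0=(0,1,0),F=(0,1,1)\}$, designated set $\{T,T_0,\mathsf{b}\}$, and operations $z\tilde\land w=(z_1\sqcap w_1,\ z_2\sqcup w_2,\ (z_1\sqcap z_3\sqcap w_1\sqcap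 w_3)\sqcup(z_2\sqcap z_3)\sqcup(w_2\sqcap w_3))$; $z\tilde\lor w=(z_1\sqcup w_1,\ z_2\sqcap w_2,\ (z_2\sqcap z_3\sqcap w_2\sqcap w_3)\sqcup(z_1\sqcap z_3)\sqcup(w_1\sqcap w_3))$; $\tilde\neg z=(z_2,z_1,z_3)$; $\tilde\circ z=(z_3,\sim z_3,1)$; $\models_{\mathcal{M}^1_6}$ is the usual matrix consequence (every homomorphic valuation sending $\Gamma$ into the designated set sends $A$ into it). *)

(* Defs.v *)
From mathcomp Require Import all_boot.
From mathcomp Require Import boolp classical_sets.

Set Implicit Arguments.
Unset Strict Implicit.
Unset Printing Implicit Defensive.

Local Open Scope classical_set_scope.

Inductive form : Type :=
| Var of nat
| Conj of form & form
| Disj of form & form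
| Neg of form
| Circ of form.

(* [markT A] and [markF A] are the abbreviations A^T and A^F. *)
Definition markT (A : form) : form := Conj (Circ A) A.
Definition markF (A : form) : form := Conj (Circ A) (Neg A).

(* [derives G A]: there is a natural deduction derivation of A all of whose
   undischarged assumptions belong to the (possibly infinite) set G.  The
   subderivations from a dischargeable assumption [B] use the set B |` G. *)
Inductive derives : set form -> form -> Prop :=
| D_assum G A : G A -> derives G A
| D_andI G A B : derives G A -> derives G B -> derives G (Conj A B)
| D_andE1 G A B : derives G (Conj A B) -> derives G A
| D_andE2 G A B : derives G (Conj A B) -> derives G B
| D_orI1 G A B : derives G A -> derives G (Disj A B)
| D_orI2 G A B : derives G B -> derives G (Disj A B)
| D_orE G A B C : derives G (Disj A B) ->
    derives (A |` G) C -> derives (B |` G) C -> derives G C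
| D_nandI1 G A B : derives G (Neg A) -> derives G (Neg (Conj A B))
| D_nandI2 G A B : derives G (Neg B) -> derives G (Neg (Conj A B))
| D_nandE G A B C : derives G (Neg (Conj A B)) ->
    derives (Neg A |` G) C -> derives (Neg B |` G) C -> derives G C
| D_norI G A B : derives G (Neg A) -> derives G (Neg B) ->
    derives G (Neg (Disj A B))
| D_norE1 G A B : derives G (Neg (Disj A B)) -> derives G (Neg A)
| D_norE2 G A B : derives G (Neg (Disj A B)) -> derives G (Neg B)
| D_dnI G A : derives G A -> derives G (Neg (Neg A))
| D_dnE G A : derives G (Neg (Neg A)) -> derives G A
| D_exp G A B : derives G (Circ A) -> derives G A -> derives G (Neg A) ->
    derives G B
| D_pem G A : derives G (Circ A) -> derives G (Disj A (Neg A))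
| D_circcirc G A : derives G (Circ (Circ A))
| D_ncircI G A : derives G (Circ A) -> derives G (Circ (Neg A))
| D_ncircE G A : derives G (Circ (Neg A)) -> derives G (Circ A)
| D_andTI G A B : derives G (markT A) -> derives G (markT B) ->
    derives G (markT (Conj A B))
| D_andFI1 G A B : derives G (markF A) -> derives G (markF (Conj A B))
| D_andFI2 G A B : derives G (markF B) -> derives G (markF (Conj A B))
| D_orTI1 G A B : derives G (markT A) -> derives G (markT (Disj A B))
| D_orTI2 G A B : derives G (markT B) -> derives G (markT (Disj A B))
| D_orFI G A B : derives G (markF A) -> derives G (markF B) ->
    derives G (markF (Disj A B))
| D_andTE1 G A B : derives G (markT (Conj A B)) -> derives G (markT A)
| D_andTE2 G A B : derives G (markT (Conj A B)) -> derives G (markT B)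
| D_andFE G A B C : derives G (markF (Conj A B)) ->
    derives (markF A |` G) C -> derives (markF B |` G) C -> derives G C
| D_orTE G A B C : derives G (markT (Disj A B)) ->
    derives (markT A |` G) C -> derives (markT B |` G) C -> derives G C
| D_orFE1 G A B : derives G (markF (Disj A B)) -> derives G (markF A)
| D_orFE2 G A B : derives G (markF (Disj A B)) -> derives G (markF B).

Record bivaluation (rho : form -> bool) : Prop := Bivaluation {
  bv_and : forall A B, rho (Conj A B) <-> rho A /\ rho B;
  bv_or : forall A B, rho (Disj A B) <-> rho A \/ rho B;
  bv_dn : forall A, rho (Neg (Neg A)) <-> rho A;
  bv_nand : forall A B, rho (Neg (Conj A B)) <-> rho (Neg A) \/ rho (Neg B);
  bv_nor : forall A B, rho (Neg (Disj A B)) <-> rho (Neg A) /\ rho (Neg B);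
  bv_circ : forall A, rho (Circ A) -> (rho (Neg A) <-> rho A = false);
  bv_vp1 : forall A, rho (Circ (Circ A));
  bv_vp2 : forall A, rho (Circ (Neg A)) = rho (Circ A);
  bv_vp3 : forall A B, rho (Circ A) /\ rho A -> rho (Circ B) /\ rho B ->
    rho (Circ (Conj A B));
  bv_vp4 : forall A B, rho (Circ A) /\ rho (Neg A) -> rho (Circ (Conj A B));
  bv_vp5 : forall A B, rho (Circ B) /\ rho (Neg B) -> rho (Circ (Conj A B));
  bv_vp6 : forall A B, rho (Circ (Conj A B)) -> rho A -> rho B ->
    rho (Circ A) /\ rho (Circ B);
  bv_vp7 : forall A B, rho (Circ (Conj A B)) -> rho (Neg A) \/ rho (Neg B) ->
    (rho (Circ A) /\ rho (Neg A)) \/ (rho (Circ B) /\ rho (Neg B));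
  bv_vp8 : forall A B, rho (Circ A) /\ rho A -> rho (Circ (Disj A B));
  bv_vp9 : forall A B, rho (Circ B) /\ rho B -> rho (Circ (Disj A B));
  bv_vp10 : forall A B, rho (Circ A) /\ rho (Neg A) ->
    rho (Circ B) /\ rho (Neg B) -> rho (Circ (Disj A B));
  bv_vp11 : forall A B, rho (Circ (Disj A B)) -> rho A \/ rho B ->
    (rho (Circ A) /\ rho A) \/ (rho (Circ B) /\ rho B);
  bv_vp12 : forall A B, rho (Circ (Disj A B)) ->
    rho A = false -> rho B = false -> rho (Circ A) /\ rho (Circ B)
}.

Definition biv_consequence (G : set form) (A : form) : Prop :=
  forall rho : form -> bool, bivaluation rho ->
    (forall B, G B -> rho B) -> rho A.

Record logical_matrix := LogicalMatrix {
  mx_dom : Type;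
  mx_desig : set mx_dom;
  mx_and : mx_dom -> mx_dom -> mx_dom;
  mx_or : mx_dom -> mx_dom -> mx_dom;
  mx_neg : mx_dom -> mx_dom;
  mx_circ : mx_dom -> mx_dom
}.

Record mx_valuation (M : logical_matrix) (v : form -> mx_dom M) : Prop :=
  MxValuation {
    mv_and : forall A B, v (Conj A B) = mx_and (v A) (v B);
    mv_or : forall A B, v (Disj A B) = mx_or (v A) (v B);
    mv_neg : forall A, v (Neg A) = mx_neg (v A);
    mv_circ : forall A, v (Circ A) = mx_circ (v A)
  }.

Definition mx_consequence (M : logical_matrix) (G : set form) (A : form) :
    Prop :=
  forall v : form -> mx_dom M, mx_valuation v ->
    (forall B, G B -> mx_desig (v B)) -> mx_desig (v A).

Definition triple : Type := (bool * bool * bool)%type.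
Definition pr1 (z : triple) : bool := z.1.1.
Definition pr2 (z : triple) : bool := z.1.2.
Definition pr3 (z : triple) : bool := z.2.

(* On bool, [x ==> y] is the Boolean order x <= y. *)
Definition in_BLETK (z : triple) : bool :=
  (pr3 z ==> pr1 z || pr2 z) && ([&& pr1 z, pr2 z & pr3 z] == false).

Definition BLETK : Type := {z : triple | in_BLETK z}.

Definition and3 (z w : triple) : triple :=
  (pr1 z && pr1 w, pr2 z || pr2 w,
   [|| [&& pr1 z, pr3 z, pr1 w & pr3 w], pr2 z && pr3 z | pr2 w && pr3 w]).
Definition or3 (z w : triple) : triple :=
  (pr1 z || pr1 w, pr2 z && pr2 w,
   [|| [&& pr2 z, pr3 z, pr2 w & pr3 w], pr1 z && pr3 z | pr1 w && pr3 w]).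
Definition neg3 (z : triple) : triple := (pr2 z, pr1 z, pr3 z).
Definition circ3 (z : triple) : triple := (pr3 z, ~~ pr3 z, true).

Lemma and3_in (z w : BLETK) : in_BLETK (and3 (val z) (val w)).
Proof.
by case: z w => [[[[] []] []] hz] [[[[] []] []] hw] //=;
  move: hz hw; rewrite /in_BLETK.
Qed.

Lemma or3_in (z w : BLETK) : in_BLETK (or3 (val z) (val w)).
Proof.
by case: z w => [[[[] []] []] hz] [[[[] []] []] hw] //=;
  move: hz hw; rewrite /in_BLETK.
Qed.

Lemma neg3_in (z : BLETK) : in_BLETK (neg3 (val z)).
Proof. by case: z => [[[[] []] []] hz]. Qed.

Lemma circ3_in (z : BLETK) : in_BLETK (circ3 (val z)).
Proof. by case: z => [[[[] []] []] hz]. Qed.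

Definition B_and (z w : BLETK) : BLETK := exist in_BLETK _ (and3_in z w).
Definition B_or (z w : BLETK) : BLETK := exist in_BLETK _ (or3_in z w).
Definition B_neg (z : BLETK) : BLETK := exist in_BLETK _ (neg3_in z).
Definition B_circ (z : BLETK) : BLETK := exist in_BLETK _ (circ3_in z).

Definition B_T : BLETK := exist in_BLETK (true, false, true) erefl.
Definition B_T0 : BLETK := exist in_BLETK (true, false, false) erefl.
Definition B_b : BLETK := exist in_BLETK (true, true, false) erefl.

Definition M61 : logical_matrix :=
  @LogicalMatrix BLETK [set B_T; B_T0; B_b] B_and B_or B_neg B_circ.

(* Main.v *)
Require Import Defs.
From mathcomp Require Import all_boot.
From mathcomp Require Import boolp classical_sets.

(* The three relations are related in a cycle.  Each rule is sound for the
   six-valued matrix by inspection of the values of its formulas.  A bivaluation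
   rho yields the matrix valuation B |-> (rho B, rho (Neg B), rho (Circ B)), so
   matrix consequence implies consequence over bivaluations.  Completeness is a
   Lindenbaum argument: a set that is maximal among those not deriving A is a
   prime theory, and its characteristic function is a bivaluation. *)

Set Implicit Arguments.
Unset Strict Implicit.
Unset Printing Implicit Defensive.

Local Open Scope classical_set_scope.

Lemma derives_weaken (G H : set form) A :
  G `<=` H -> derives G A -> derives H A.
Proof.
move=> GH dA; elim: dA H GH => {G A}.
  by move=> G A GA H GH; apply/D_assum/GH.
all: intros; repeat match goal with
  | IH : forall H, ?G `<=` H -> _, GH : ?G `<=` ?H |- _ => move: {IH}(IH _ GH) => IH
  | IH : forall H, ?B `|` ?G `<=` H -> _, GH : ?G `<=` ?H |- _ =>
      move: {IH}(IH _ (@setUS _ B _ _ GH)) => IH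
  end.
all: solve [econstructor; eassumption].
Qed.

(** * Compactness of derivability *)

Definition directed (F : set (set form)) : Prop :=
  F !=set0 /\
  forall X Y, F X -> F Y -> exists Z, [/\ F Z, X `<=` Z & Y `<=` Z].

(* Quantifying over all directed families lets an induction on derivations pass
   under a discharged B, by replacing F with the family of all B |` X. *)
Definition compactly_derives (G : set form) (A : form) : Prop :=
  forall F, directed F -> G `<=` \bigcup_(X in F) X ->
  exists2 X, F X & derives X A.

Lemma compactly_rule1 G A B :
  (forall X, derives X B -> derives X A) ->
  compactly_derives G B -> compactly_derives G A.
Proof.
by move=> rule cB F dirF GF; have [X FX /rule dA] := cB F dirF GF; exists X.
Qed.

Lemma compactly_rule2 G A B C :
  (forall X, derives X B -> derives X C -> derives X A) ->
  compactly_derives G B -> compactly_derives G C -> compactly_derives G A.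
Proof.
move=> rule cB cC F dirF GF.
have [X FX dB] := cB F dirF GF; have [Y FY dC] := cC F dirF GF.
have [Z [FZ XZ YZ]] := dirF.2 _ _ FX FY.
by exists Z => //; apply: rule; [apply: derives_weaken dB|apply: derives_weaken dC].
Qed.

Lemma compactly_discharge G A B F :
  compactly_derives (B |` G) A -> directed F -> G `<=` \bigcup_(X in F) X ->
  exists2 X, F X & derives (B |` X) A.
Proof.
move=> cA [[X0 FX0] dirF] GF.
have [| |_ [X FX <-] dA] := cA [set B |` X | X in F]; last by exists X.
- split; first by exists (B |` X0), X0.
  move=> _ _ [X FX <-] [Y FY <-]; have [Z [FZ XZ YZ]] := dirF _ _ FX FY.
  by exists (B |` Z); split; [exists Z|apply: setUS|apply: setUS].
(* The union must also contain [B]; nonemptiness of [F] supplies a member of the new family to hold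
   it. *)
- move=> C [->|/GF[X FX XC]]; first by exists (B |` X0); [exists X0|left].
  by exists (B |` X); [exists X|right].
Qed.

(** Every elimination rule with two discharging branches has this shape. Its three premises are
    derived from three members of the family, and directedness used twice bounds them all. *)
Lemma compactly_cases G A B C D :
  (forall X, derives X D -> derives (B |` X) A -> derives (C |` X) A ->
    derives X A) ->
  compactly_derives G D -> compactly_derives (B |` G) A ->
  compactly_derives (C |` G) A -> compactly_derives G A.
Proof.
move=> rule cD cB cC F dirF GF; have [X FX dD] := cD F dirF GF.
have [Y FY dB] := compactly_discharge cB dirF GF.
have [Z FZ dC] := compactly_discharge cC dirF GF.
have [U [FU XU YU]] := dirF.2 _ _ FX FY.
have [V [FV UV ZV]] := dirF.2 _ _ FU FZ.
exists V => //; apply: rule.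
- exact: derives_weaken (subset_trans XU UV) dD.
- by apply: derives_weaken dB; apply/setUS/(subset_trans YU UV).
- by apply: derives_weaken dC; apply/setUS.
Qed.

Lemma derives_compact G A : derives G A -> compactly_derives G A.
Proof.
move=> dA; elim: {G A} dA.
- by move=> G A GA F _ /(_ _ GA)[X FX XA]; exists X => //; apply: D_assum.
all: try by intros; match goal with
  | c : compactly_derives _ _ |- _ =>
      solve [apply: compactly_rule1 c => X *; econstructor; eassumption]
  | c : compactly_derives _ _, c' : compactly_derives _ _ |- _ =>
      solve [apply: compactly_rule2 c c' => X *; econstructor; eassumption]
  | c : compactly_derives _ _, c' : compactly_derives _ _,
    c'' : compactly_derives _ _ |- _ =>
      solve [apply: compactly_cases c c' c'' => X *; econstructor; eassumption]
  end.
(* [D_exp] has three premises and discharges nothing, so it fits none of the schemes; its last two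
   premises are first merged into a conjunction. *)
- move=> G A B _ cO _ cA _ cN.
  apply: (@compactly_rule2 _ _ (Circ A) (Conj A (Neg A))) => //.
  + by move=> X dO dAN; apply: D_exp dO (D_andE1 dAN) (D_andE2 dAN).
  + by apply: compactly_rule2 cA cN => X; apply: D_andI.
- by move=> G A F [[X FX] _] _; exists X; last exact: D_circcirc.
Qed.

(** * Soundness for the six-valued matrix *)

Lemma M61_desigE (z : BLETK) : mx_desig (l := M61) z <-> pr1 (val z).
Proof.
split; first by case=> [[]|] ->.
have inj (w : BLETK) : val z = val w -> z = w by exact: val_inj.
(* Among the triples with first coordinate 1 only (1,1,1) is not designated, and it lies outside the
   domain. *)
case Ez: (val z) => [[[] []] []] // _; have := valP z; rewrite ?Ez // => _.
- by right; apply: inj; rewrite Ez.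
- by left; left; apply: inj; rewrite Ez.
- by left; right; apply: inj; rewrite Ez.
Qed.

Lemma derives_mx_sound (G : set form) A :
  derives G A -> mx_consequence M61 G A.
Proof.
move=> dA v [vand vor vneg vcirc]; pose t B := val (v B).
have tand B C : t (Conj B C) = Defs.and3 (t B) (t C) by rewrite /t vand.
have tor B C : t (Disj B C) = Defs.or3 (t B) (t C) by rewrite /t vor.
have tneg B : t (Neg B) = neg3 (t B) by rewrite /t vneg.
have tcirc B : t (Circ B) = circ3 (t B) by rewrite /t vcirc.
have tin B : in_BLETK (t B) by exact: valP.
suff sound : (forall B, G B -> pr1 (t B)) -> pr1 (t A).
  by move=> GB; apply/M61_desigE/sound => B /GB/M61_desigE.
(* With its body forgotten, [t] is just a map into admissible triples that respects the connectives.
   [discharge] recasts an induction hypothesis under a discharged [B] as an implication from the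
   designation of [B]. *)
clearbody t; have discharge (H : set form) B C :
    ((forall D, (B |` H) D -> pr1 (t D)) -> pr1 (t C)) ->
    (forall D, H D -> pr1 (t D)) -> pr1 (t B) -> pr1 (t C).
  by move=> IH HD tB; apply: IH => D [->|/HD].
elim: {G A} dA; first by move=> G A GA; apply.
all: intros; repeat match goal with
  | IH : (forall X, ?G X -> _) -> _, GB : forall X, ?G X -> _ |- _ => move: {IH}(IH GB)
  | IH : (forall X, (?B |` ?G) X -> _) -> _, GB : forall X, ?G X -> _ |- _ =>
      move: {IH}(discharge _ _ _ IH GB)
  end.
all: rewrite /markT /markF ?(tand, tor, tneg, tcirc).
(* Each remaining value of [t] becomes an arbitrary admissible triple, so every rule reduces to a
   finite truth-table check. *)
all: repeat match goal with
  | tin : forall B, is_true (in_BLETK (?t B)) |- context [?t ?X] =>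
      move: (t X) (tin X)
  end.
all: repeat (case=> [[[] []] []]; first [by [] | move=> _]).
all: try by rewrite /=; intuition.
Qed.

(** * From bivaluations to matrix valuations *)

Lemma mx_biv_consequence (G : set form) A :
  mx_consequence M61 G A -> biv_consequence G A.
Proof.
move=> mxGA rho rhoP GB.
have ifft (a b : bool) : (a <-> b) -> a = b by move=> ab; apply/idP/idP => /ab.
have rcirc B : rho (Circ B) -> rho (Neg B) = ~~ rho B.
  by move=> /(bv_circ rhoP) negB; apply/ifft; rewrite negB; split=> [->|/negbTE].
pose t B : triple := (rho B, rho (Neg B), rho (Circ B)).
(* Membership says that the first two coordinates are complementary whenever the third is 1, which
   is [rcirc]. *)
have tin B : in_BLETK (t B).
  rewrite /in_BLETK /pr1 /pr2 /pr3 /=; have := @rcirc B.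
  by case: (rho (Circ B)) => [/(_ isT)->|_]; case: (rho B) (rho (Neg B)) => [] [].
pose v B : BLETK := exist in_BLETK _ (tin B).
suff vP : mx_valuation (M := M61) v.
  by apply/(M61_desigE (v A))/mxGA => // B /GB rhoB; apply/M61_desigE.
have rand B C : rho (Conj B C) = rho B && rho C.
  by apply/ifft; rewrite (bv_and rhoP); split=> /andP.
have ror B C : rho (Disj B C) = rho B || rho C.
  by apply/ifft; rewrite (bv_or rhoP); split=> /orP.
have rnand B C : rho (Neg (Conj B C)) = rho (Neg B) || rho (Neg C).
  by apply/ifft; rewrite (bv_nand rhoP); split=> /orP.
have rnor B C : rho (Neg (Disj B C)) = rho (Neg B) && rho (Neg C).
  by apply/ifft; rewrite (bv_nor rhoP); split=> /andP.
split=> [B C|B C|B|B]; apply: val_inj;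
  rewrite /= /Defs.and3 /Defs.or3 /neg3 /circ3 /pr1 /pr2 /pr3 /t /=.
(* Only the third coordinate needs work. Under [rO] the conjunction and its negation are
   complementary by [rcirc]: vp6 settles the true case and vp7 the false one. Conversely, vp3 to vp5
   match the three disjuncts. *)
- rewrite rand rnand; congr (_, _, _); apply/ifft; split=> [rO|].
    have := rcirc _ rO; rewrite rand rnand.
    case: (boolP (rho B && rho C)) => [/andP[rB rC] _|_ /orP].
      by have [-> ->] := bv_vp6 rhoP rO rB rC; rewrite rB rC.
    by move=> /(bv_vp7 rhoP rO)[][-> ->]; rewrite !orbT.
  case/or3P=> [/and4P[rB cB rC cC]|/andP[]|/andP[]].
  + exact: (@bv_vp3 _ rhoP B C (conj cB rB) (conj cC rC)).
  + by move=> nB cB; apply: (@bv_vp4 _ rhoP B C (conj cB nB)).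
  + by move=> nC cC; apply: (@bv_vp5 _ rhoP B C (conj cC nC)).
- rewrite ror rnor; congr (_, _, _); apply/ifft; split=> [rO|].
    case: (boolP (rho B || rho C)) => [/orP|].
      by move=> /(bv_vp11 rhoP rO)[][-> ->]; rewrite !orbT.
    rewrite negb_or => /andP[/negPf rB /negPf rC].
    have [cB cC] := bv_vp12 rhoP rO rB rC.
    (* vp12 speaks only of [Circ]; [rcirc] then makes both negations true. *)
    by rewrite !rcirc // rB rC cB cC.
  case/or3P=> [/and4P[nB cB nC cC]|/andP[]|/andP[]].
  + exact: (@bv_vp10 _ rhoP B C (conj cB nB) (conj cC nC)).
  + by move=> rB cB; apply: (@bv_vp8 _ rhoP B C (conj cB rB)).
  + by move=> rC cC; apply: (@bv_vp9 _ rhoP B C (conj cC rC)).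
- by rewrite (bv_vp2 rhoP); congr (_, _, _); apply/ifft/(bv_dn rhoP).
(* By vp1, [rcirc] applies to [Circ B] itself and yields the complement in the second coordinate. *)
- by rewrite (bv_vp1 rhoP) (rcirc _ (bv_vp1 rhoP B)).
Qed.

(** * Lindenbaum extension and completeness *)

Lemma lindenbaum (G : set form) A : ~ derives G A ->
  exists D, [/\ G `<=` D, ~ derives D A & forall B, ~ D B -> derives (B |` D) A].
Proof.
(* Putting [G] inside the predicate, instead of requiring it to be a subset of [X], lets the empty
   chain be bounded by the empty set. *)
move=> GA; pose P (X : set form) := ~ derives (G `|` X) A.
have [|X [PX maxX]] := @Zorn_bigcup form P.
  move=> F FP Ftot; have [F0|/set0P F0] := eqVneq F set0.
    by rewrite /P F0 bigcup_set0 setU0.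
  move=> dA; have [| |_ [X FX <-] /(FP _ FX)//] :=
    @derives_compact _ _ dA [set G `|` X | X in F].
  - split; first by have [X FX] := F0; exists (G `|` X), X.
    move=> _ _ [X FX <-] [Y FY <-]; have [XY|YX] := Ftot _ _ FX FY.
    + by exists (G `|` Y); split; [exists Y|apply: setUS|].
    + by exists (G `|` X); split; [exists X| |apply: setUS].
  - have [X0 FX0] := F0; move=> B [GB|[X FX XB]].
      by exists (G `|` X0); [exists X0|left].
    by exists (G `|` X); [exists X|right].
exists (G `|` X); split=> // B XB.
apply: contrapT => dA; apply: (maxX (B |` X)); last by rewrite /P setUCA.
split; first exact: subsetUr.
by move=> BX; apply: XB; right; apply: BX; left.
Qed.

Lemma biv_complete (G : set form) A : biv_consequence G A -> derives G A.
Proof.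
move=> bivA; apply: contrapT => /lindenbaum[D [GD DA maxD]].
have mem B : derives D B -> D B.
  (* Cut is simulated: [Disj B B] is derived, then eliminated with the same derivation in both
     branches. *)
  move=> dB; apply: contrapT => /maxD dA; apply: DA.
  exact: (D_orE (D_orI1 B dB) dA dA).
have der B : D B -> derives D B by exact: D_assum.
(* The hypothesis is an elimination rule whose major premise is already supplied, with conclusion
   [A]. One argument thus serves all four branching eliminations. *)
have prime B C : (derives (B |` D) A -> derives (C |` D) A -> derives D A) -> D B \/ D C.
  move=> elimBC; apply: contrapT => /not_orP[/maxD dB /maxD dC].
  exact/DA/elimBC.
have andE B C : D (Conj B C) <-> D B /\ D C.
  split=> [/der d|[/der dB /der dC]]; last exact/mem/D_andI.
  by split; apply: mem; [apply: D_andE1 d|apply: D_andE2 d].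
have orE B C : D (Disj B C) -> D B \/ D C by move=> /der d; apply/prime/D_orE.
have andTE B C : D (markT (Conj B C)) -> D (markT B) /\ D (markT C).
  by move=> /der d; split; apply: mem; [apply: D_andTE1 d|apply: D_andTE2 d].
have andFE B C : D (markF (Conj B C)) -> D (markF B) \/ D (markF C).
  by move=> /der d; apply/prime/D_andFE.
have orTE B C : D (markT (Disj B C)) -> D (markT B) \/ D (markT C).
  by move=> /der d; apply/prime/D_orTE.
have orFE B C : D (markF (Disj B C)) -> D (markF B) /\ D (markF C).
  by move=> /der d; split; apply: mem; [apply: D_orFE1 d|apply: D_orFE2 d].
have orI B C : D B \/ D C -> D (Disj B C).
  by case=> /der d; apply: mem; [apply: D_orI1|apply: D_orI2].
have nandI B C : D (Neg B) \/ D (Neg C) -> D (Neg (Conj B C)).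
  by case=> /der d; apply: mem; [apply: D_nandI1|apply: D_nandI2].
have negE B : D (Circ B) -> (D (Neg B) <-> ~ D B).
  move=> /der dO; split=> [/der dN /der dB|DB].
    exact: (DA (D_exp A dO dB dN)).
  by have [] := orE _ _ (mem _ (D_pem dO)).
pose rho B := `[< D B >].
have rhoE B : rho B <-> D B by split=> /asboolP.
have rhoF B : rho B = false <-> ~ D B by split=> [/asboolPn|/asboolPn/negbTE].
suff rhoP : bivaluation rho.
  by apply/DA/der/rhoE/bivA => // B /GD/rhoE.
(* Rewriting backwards with [andE] folds pairs of memberships into [markT] or [markF] formulas, so
   that many clauses take the form of the corresponding rules. *)
split=> [B C|B C|B|B C|B C|B|B|B|B C|B C|B C|B C|B C|B C|B C|B C|B C|B C];
  rewrite ?rhoE ?rhoF -?andE.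
- by [].
- by split=> [/orE|/orI].
- by split=> /der d; apply: mem; [apply: D_dnE|apply: D_dnI].
- by split=> [/der d|/nandI//]; apply/prime/D_nandE.
- split=> [/der d|/andE[/der dB /der dC]]; last exact/mem/D_norI.
  by apply/andE; split; apply: mem; [apply: D_norE1 d|apply: D_norE2 d].
- exact: negE.
- exact/mem/D_circcirc.
- apply/idP/idP => /rhoE/der d; apply/rhoE/mem; [exact: D_ncircE|exact: D_ncircI].
- by move=> /der dB /der dC; have /mem/andE[] := D_andTI dB dC.
- by move=> /der dB; have /mem/andE[] := D_andFI1 C dB.
- by move=> /der dC; have /mem/andE[] := D_andFI2 B dC.
- move=> dO dB dC; have /andTE[] : D (markT (Conj B C)) by rewrite !andE.
  by rewrite !andE => -[? _] [].
- by move=> dO /nandI dN; apply: andFE; rewrite andE.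
- by move=> /der dB; have /mem/andE[] := D_orTI1 C dB.
- by move=> /der dC; have /mem/andE[] := D_orTI2 B dC.
- by move=> /der dB /der dC; have /mem/andE[] := D_orFI dB dC.
- by move=> dO /orI d; apply: orTE; rewrite andE.
(* By primeness [Disj B C] is outside [D], so [negE] places its negation in [D]. *)
- move=> dO dB dC; have /orFE[] : D (markF (Disj B C)).
    by rewrite andE negE //; split=> // /orE[].
  by rewrite !andE => -[? _] [].
Qed.

Theorem theorem5p2 (G : set form) (A : form) :
  (derives G A <-> biv_consequence G A) /\
  (biv_consequence G A <-> mx_consequence M61 G A).
Proof.
split; split.
- by move=> /derives_mx_sound/mx_biv_consequence.
- exact: biv_complete.
- by move=> /biv_complete/derives_mx_sound.
- exact: mx_biv_consequence.
Qed.
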